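(* Let ${\cal F}$ be a Fano plane and let $\mathbb F$ be a field of characteristic not $2$. Then the group $\mathrm{Aut}({\cal F})$ acts transitively on each of the three sets ${\cal F}_0$ (oriented maps), $\mathbb O_{{\cal F},1}^+$ and $\mathbb O_{{\cal F},1}^-$ (defined in the context).
   Context: A Fano plane ${\cal F}$ is a projective plane with seven points and seven lines; ${\cal F}^\ast$ denotes its set of lines. $V_{\cal F}={\cal F}\cup\{0\}$ is the three-dimensional $\mathbb Z_2$-vector space with zero $0$, where $P+P=0$, $P+0=P$, and for distinct $P,Q\in{\cal F}$, $P+Q$ is the third point on the line through $P$ and $Q$. $V_{\cal F}^\ast$ is its dual. $\mathrm{Aut}({\cal F})$ is the group of bijections ${\cal F}\to{\cal F}$ sending lines to lines (it is identified with $GL(V_{\cal F})$). $S_2=\{1,-1\}$. An oriented map is a map $\alpha:{\cal F}\to V_{\cal F}^\ast$, $P\mapsto\alpha_P$, such that $\alpha_P(P)=1$ for all $P$ and $\alpha_P(Q)+\alpha_Q(P)=1$ for all $P\neq Q$; ${\cal F}_0$ is the set of oriented maps, with action $(g\cdot\alpha)_P(Q)=\alpha_{g^{-1}P}(g^{-1}Q)$. Let $\mathbb O_{\cal F}$ be the $8$-dimensional $\mathbb F$-vector space with basis $1$ and $e_P$ ($P\in{\cal F}$). A multiplication factor is a map $\epsilon$ from ordered pairs of distinct points to $S_2$ with $\epsilon_{QP}=-\epsilon_{PQ}$; it defines the bilinear product on $\mathbb O_{\cal F}$ with unit $1$, $e_Pe_Q=\epsilon_{PQ}e_{P+Q}$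 ($P\neq Q$), $e_Pe_P=-1$. It is a composition factor if $N(ZW)=N(Z)N(W)$ for all $Z,W$, where $N(\lambda^01+\sum_P\lambda^Pe_P)=(\lambda^0)^2+\sum_P(\lambda^P)^2$. The future of $P$ is $\{Q:\epsilon_{PQ}=1\}$ and its past is $\{Q:\epsilon_{PQ}=-1\}$. $\mathbb O_{{\cal F},1}^+$ (resp. $\mathbb O_{{\cal F},1}^-$) is the set of composition factors $\epsilon$ such that for every $P\in{\cal F}$ the future (resp. past) of $P$ is a line. $\mathrm{Aut}({\cal F})$ acts on composition factors by $(g\cdot\epsilon)_{PQ}=\epsilon_{g^{-1}P\,g^{-1}Q}$. *)

(* Defs.v *)
From HB Require Import structures.
From mathcomp Require Import all_boot all_order all_algebra all_fingroup.
From mathcomp Require Import boolp.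

Set Implicit Arguments.
Unset Strict Implicit.
Unset Printing Implicit Defensive.

Import GRing.Theory.
Local Open Scope ring_scope.

(* Lines are identified with their sets of points.  The quadrangle axiom
   excludes the degenerate planes with seven points and seven lines (such as
   the near-pencil), which satisfy the other axioms. *)
Record fanoPlane := FanoPlane {
  point :> finType;
  lines : {set {set point}};
  card_points : #|point| = 7%N;
  card_lines : #|lines| = 7%N;
  fano_join : forall P Q : point, P != Q ->
    #|[set l in lines | (P \in l) && (Q \in l)]| = 1%N;
  fano_meet : {in lines &, forall l m : {set point}, l != m ->
    #|l :&: m| = 1%N};
  fano_quadrangle : exists X : {set point},
    #|X| = 4%N /\ {in lines, forall l : {set point}, (#|X :&: l| <= 2)%N}
}.

Section FanoVectorSpace.
Variable F : fanoPlane.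

Definition third (P Q : F) : F :=
  odflt P [pick R | [&& R != P, R != Q &
    [exists l in lines F, [&& P \in l, Q \in l & R \in l]]]].

Definition fanoV : Type := option F.

Definition fano_add (u v : fanoV) : fanoV :=
  match u, v with
  | None, _ => v
  | _, None => u
  | Some P, Some Q => if P == Q then None else Some (third P Q)
  end.

Lemma line_unique (P Q : F) (l m : {set F}) : P != Q ->
  l \in lines F -> m \in lines F -> P \in l -> Q \in l -> P \in m -> Q \in m ->
  l = m.
Proof.
move=> PQ lF mF Pl Ql Pm Qm; have /eqP/cards1P[k kE] := fano_join PQ.
have /[!inE]/eqP-> : l \in [set k] by rewrite -kE inE lF Pl.
by have /[!inE]/eqP-> : m \in [set k] by rewrite -kE inE mF Pm.
Qed.

Lemma line_exists (P Q : F) : P != Q ->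
  exists l, [/\ l \in lines F, P \in l & Q \in l].
Proof.
move=> PQ; have /eqP/cards1P[k kE] := fano_join PQ; exists k.
by have := set11 k; rewrite -kE inE => /and3P[].
Qed.

Lemma point_unique (l m : {set F}) (P Q : F) : l \in lines F -> m \in lines F ->
  l != m -> P \in l -> P \in m -> Q \in l -> Q \in m -> P = Q.
Proof.
move=> lF mF lm Pl Pm Ql Qm; have /eqP/cards1P[k kE] := fano_meet lF mF lm.
have /[!inE]/eqP-> : P \in [set k] by rewrite -kE inE Pl.
by have /[!inE]/eqP-> : Q \in [set k] by rewrite -kE inE Ql.
Qed.

Let pencil (P : F) := [set l in lines F | P \in l].

Lemma card_pencil (l : {set F}) (P : F) : l \in lines F -> P \notin l ->
  #|pencil P| = #|l|.
Proof.
move=> lF Pl.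
have -> : #|l| = (\sum_(Q in l) \sum_(m in pencil P) if Q \in m then 1 else 0)%N.
  rewrite -sum1_card; apply: eq_bigr => Q Ql.
  rewrite -big_mkcondr sum1dep_card -[LHS](@fano_join F P Q); last first.
    by apply: contraNneq Pl => ->.
  by apply: eq_card => m; rewrite !inE andbA.
rewrite exchange_big -sum1_card /=; apply: eq_bigr => m; rewrite inE => /andP[mF Pm].
have lm : l != m by apply: contraNneq Pl => ->.
rewrite -big_mkcondr sum1dep_card -[LHS](fano_meet lF mF lm).
by apply: eq_card => Q; rewrite !inE.
Qed.

Lemma card_flags (l : {set F}) : l \in lines F ->
  (\sum_(m in lines F) #|m| = #|l| + 6 + (7 - #|l|) * #|l|)%N.
Proof.
move=> lF; under eq_bigr do rewrite -sum1_card big_mkcond.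
rewrite exchange_big /= (bigID (mem l)) /=; congr (_ + _)%N; last first.
  rewrite (eq_bigr (fun=> #|l|)) => [|P Pl]; last first.
    rewrite -(card_pencil lF Pl) -big_mkcondr sum1dep_card.
    by apply: eq_card => m; rewrite !inE.
  by rewrite sum_nat_const -(card_points F) -(cardC (mem l)) addKn.
rewrite exchange_big (bigD1 l) //=; congr (_ + _)%N.
  by rewrite -big_mkcondr -sum1_card; apply: eq_bigl => P; rewrite andbb.
rewrite (eq_bigr (fun=> 1%N)) => [|m /andP[mF ml]].
  have := cardsD1 l (lines F); rewrite lF (card_lines F) => -[->].
  by rewrite -sum1_card; apply: eq_bigl => m; rewrite !inE andbC.
rewrite -big_mkcondr sum1dep_card -[RHS](@fano_meet F l m) 1?eq_sym //.
Qed.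

Lemma card_line (l : {set F}) : l \in lines F -> #|l| = 3%N.
Proof.
have le5 m : m \in lines F -> (#|m| <= 5)%N.
  move=> mF; have [X [X4 Xm]] := fano_quadrangle F.
  have := Xm m mF; have := max_card (mem (X :|: m)).
  rewrite (card_points F) cardsU X4; case: #|m| => [|[|[|[|[|[|n]]]]]] //.
  by case: #|_| => [|[|[|]]].
move=> lF; have lS := card_flags lF.
have mS m : m \in lines F -> (#|m| + 6 + (7 - #|m|) * #|m| =
    #|l| + 6 + (7 - #|l|) * #|l|)%N.
  by move=> mF; rewrite -lS -card_flags.
case: (boolP [forall m in lines F, #|m| == #|l|]) => [/forall_inP eql|].
  move: lS; rewrite (eq_bigr (fun=> #|l|)) => [|m /eql/eqP//].
  rewrite sum_nat_const (card_lines F); move: (le5 l lF).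
  by case: #|l| => [|[|[|[|[|[|n]]]]]].
have ge3 : (5 <= #|l|)%N \/ #|l| = 3%N ->
    forall m, m \in lines F -> (3 <= #|m|)%N.
  move=> l35 m mF; move: (mS m mF) (le5 m mF) (le5 l lF) l35.
  by case: #|m| => [|[|[|m']]] //; case: #|l| => [|[|[|[|[|[|n]]]]]] //= _ _ _ [].
case/forall_inPn => m mF ml.
have [l5|//] : (5 <= #|l|)%N \/ #|l| = 3%N.
  move: (mS m mF) (le5 m mF) (le5 l lF) ml.
  case: #|m| => [|[|[|[|[|[|m']]]]]] //;
  by case: #|l| => [|[|[|[|[|[|n]]]]]] //=; auto.
have : (3 * 6 + 5 <= \sum_(m in lines F) #|m|)%N.
  rewrite (bigD1 l) //= addnC leq_add //.
  apply: (@leq_trans (\sum_(i in lines F | i != l) 3)%N); last first.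
    by apply: leq_sum => i /andP[iF _]; apply: ge3 => //; left.
  rewrite sum_nat_const mulnC leq_pmul2r //.
  have := cardsD1 l (lines F); rewrite lF (card_lines F) => -[->].
  by apply/eq_leq/eq_card => k; rewrite !inE andbC.
rewrite lS; move: l5 (le5 l lF).
by case: #|l| => [|[|[|[|[|[|n]]]]]].
Qed.

Lemma thirdP (P Q : F) (l : {set F}) : P != Q -> l \in lines F ->
  P \in l -> Q \in l ->
  [/\ third P Q \in l, third P Q != P, third P Q != Q &
      forall R, R \in l -> R != P -> R != Q -> R = third P Q].
Proof.
move=> PQ lF Pl Ql.
have PQl : [set P; Q] \subset l by apply/subsetP => R; rewrite !inE => /pred2P[]->.
have /eqP/cards1P[T TE] : #|l :\: [set P; Q]| = 1%N.
  by rewrite cardsD (setIidPr PQl) cards2 PQ card_line.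
have inT R : (R == T) = [&& R != P, R != Q & R \in l].
  by rewrite -(in_set1 R T) -TE !inE negb_or andbA.
have onl R : R != P -> [exists k in lines F, [&& P \in k, Q \in k & R \in k]] = (R \in l).
  move=> RP; apply/exists_inP/idP => [[k kF /and3P[Pk Qk Rk]]|Rl].
    by rewrite (line_unique PQ lF kF).
  by exists l; rewrite ?Pl ?Ql.
have -> : third P Q = T.
  rewrite /third; case: pickP => [R /and3P[RP RQ]|/(_ T)] /=.
    by rewrite onl // => Rl; apply/eqP; rewrite inT RP RQ.
  have := inT T; rewrite eqxx => /esym/and3P[TP TQ Tl].
  by rewrite TP TQ onl // Tl.
have := inT T; rewrite eqxx => /esym/and3P[TP TQ Tl].
by split=> // R Rl RP RQ; apply/eqP; rewrite inT RP RQ.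
Qed.

Lemma third_eq (P Q R : F) (l : {set F}) : l \in lines F ->
  P \in l -> Q \in l -> R \in l -> P != Q -> R != P -> R != Q -> third P Q = R.
Proof.
move=> lF Pl Ql Rl PQ RP RQ; have [_ _ _ Tu] := thirdP PQ lF Pl Ql.
exact/esym/Tu.
Qed.

Lemma thirdC (P Q : F) : P != Q -> third P Q = third Q P.
Proof.
move=> PQ; have [l [lF Pl Ql]] := line_exists PQ.
have [Tl TP TQ _] := thirdP PQ lF Pl Ql.
by rewrite [RHS](third_eq lF Ql Pl Tl) // eq_sym.
Qed.

Lemma thirdK (P Q : F) : P != Q -> third P (third P Q) = Q.
Proof.
move=> PQ; have [l [lF Pl Ql]] := line_exists PQ.
have [Tl TP TQ _] := thirdP PQ lF Pl Ql.
by apply: (third_eq lF) => //; rewrite eq_sym.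
Qed.

Lemma third_neq (P Q : F) : P != Q -> third P Q != P.
Proof.
move=> PQ; have [l [lF Pl Ql]] := line_exists PQ.
by have [] := thirdP PQ lF Pl Ql.
Qed.

Lemma thirdA_noncollinear (P Q R : F) : P != Q -> Q != R -> P != R ->
  R != third P Q -> third P (third Q R) = third (third P Q) R.
Proof.
move=> PQ QR PR RS.
have [l [lF Pl Ql]] := line_exists PQ; have [Sl SP SQ Su] := thirdP PQ lF Pl Ql.
have [m [mF Qm Rm]] := line_exists QR; have [Tm TQ TR Tu] := thirdP QR mF Qm Rm.
move: (third P Q) (third Q R) RS Sl SP SQ Su Tm TQ TR Tu.
move=> S T RS Sl SP SQ Su Tm TQ TR Tu.
have Rl : R \notin l by apply: contraNN RS => Rl; rewrite {1}(Su R) // eq_sym.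
have lm : l != m by apply: contraNneq Rl => ->.
have Pm : P \notin m.
  by apply: contraNN PQ => Pm; rewrite (point_unique lF mF lm Pl Pm Ql Qm).
have Sm : S \notin m.
  by apply: contraNN SQ => Sm; rewrite (point_unique lF mF lm Sl Sm Ql Qm).
have PT : P != T by apply: contraNneq Pm => ->.
have SR : S != R by rewrite eq_sym.
have [a [aF Pa Ta]] := line_exists PT; have [b [bF Sb Rb]] := line_exists SR.
have Pb : P \notin b.
  apply: contraNN Rl => Pb.
  by rewrite (line_unique SP lF bF).
have Tb : T \notin b.
  apply: contraNN Sm => Tb.
  by rewrite (line_unique TR mF bF).
have ab : a != b by apply: contraNneq Pb => <-.
have /eqP/cards1P[X XE] := fano_meet aF bF ab.
have /[!inE]/andP[Xa Xb] : X \in a :&: b by rewrite XE inE.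
have Sa : S \notin a.
  apply: contraNN Pm => Sa.
  have al : a = l by apply: (line_unique SP).
  have Tl : T \in l by rewrite -al.
  by move: TQ; rewrite (point_unique lF mF lm Tl Tm Ql Qm) eqxx.
have Ra : R \notin a.
  by apply: contraNN Pm => Ra; rewrite (line_unique TR mF aF).
rewrite (third_eq aF Pa Ta Xa) //; last 2 first.
- by apply: contraNneq Pb => <-.
- by apply: contraNneq Tb => <-.
rewrite (third_eq bF Sb Rb Xb) //.
- by apply: contraNneq Sa => <-.
- by apply: contraNneq Ra => <-.
Qed.

Lemma fano_addC : commutative fano_add.
Proof.
move=> [P|] [Q|] //=; rewrite eq_sym; case: eqP => // /eqP QP.
by rewrite thirdC // eq_sym.
Qed.

Lemma fano_add0 : left_id None fano_add.
Proof. by case. Qed.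

Lemma fano_addvv (u : fanoV) : fano_add u u = None.
Proof. by case: u => //= P; rewrite eqxx. Qed.

Lemma fano_addKl (u v : fanoV) : fano_add u (fano_add u v) = v.
Proof.
case: u v => [P|] [Q|] //=; rewrite ?eqxx //.
case: (eqVneq P Q) => [->|PQ] //=.
by rewrite eq_sym (negPf (third_neq PQ)) thirdK.
Qed.

Lemma fano_addA : associative fano_add.
Proof.
move=> u v w.
have KC x y : fano_add (fano_add x y) y = x.
  by rewrite fano_addC [fano_add x y]fano_addC fano_addKl.
case: (eqVneq u v) => [->|uv]; first by rewrite fano_addKl fano_addvv.
case: (eqVneq v w) => [<-|vw].
  by rewrite KC fano_addvv fano_addC.
case: (eqVneq u w) => [<-|uw].
  by rewrite [fano_add v u]fano_addC fano_addKl fano_addC fano_addKl.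
case: (eqVneq w (fano_add u v)) => [->|].
  by rewrite fano_addvv [fano_add u v]fano_addC fano_addKl fano_addvv.
case: u v w uv vw uw => [P|] [Q|] [R|] //= PQ QR PR; rewrite ?fano_add0 //; last first.
  by rewrite fano_addC.
have {}PQ : P != Q by [].
have {}QR : Q != R by [].
have {}PR : P != R by [].
rewrite (negPf PQ) (negPf QR) => RS; have {}RS : R != third P Q by [].
rewrite /= [third P Q == R]eq_sym (negPf RS).
case: (eqVneq P (third Q R)) => [PE|PT]; last by rewrite thirdA_noncollinear.
case/negP: RS; apply/eqP.
have [m [mF Qm Rm]] := line_exists QR; have [Tm _ _ _] := thirdP QR mF Qm Rm.
by rewrite -PE in Tm; rewrite (third_eq mF Tm Qm Rm) // eq_sym.
Qed.

HB.instance Definition _ := Finite.on fanoV.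
HB.instance Definition _ :=
  GRing.isZmodule.Build fanoV fano_addA fano_addC fano_add0 fano_addvv.

Lemma fanoV_addvv (u : fanoV) : u + u = 0.
Proof. exact: fano_addvv. Qed.

Definition fano_scale (a : 'F_2) (u : fanoV) : fanoV := u *+ a.

Lemma fano_scaleA a b u :
  fano_scale a (fano_scale b u) = fano_scale (a * b) u.
Proof.
case: a b => [[|[|?]] ?] // [[|[|?]] ?] //=;
by rewrite /fano_scale /= ?mulr0n ?mul0rn ?mulr1n.
Qed.

Lemma fano_scale1 : left_id 1 fano_scale.
Proof. by move=> u; rewrite /fano_scale /= mulr1n. Qed.

Lemma fano_scaleDr : right_distributive fano_scale +%R.
Proof. by move=> a u v; rewrite /fano_scale mulrnDl. Qed.

Lemma fano_scaleDl u : {morph fano_scale^~ u : a b / a + b}.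
Proof.
case=> [[|[|?]] ?] // [[|[|?]] ?] //=;
by rewrite /fano_scale /= ?mulr0n ?mulr1n ?addr0 ?add0r ?fanoV_addvv.
Qed.

HB.instance Definition _ := GRing.Zmodule_isLmodule.Build 'F_2 fanoV
  fano_scaleA fano_scale1 fano_scaleDr fano_scaleDl.

Definition fano_pt (P : F) : fanoV := Some P.

Definition fano_dual : {set {ffun fanoV -> 'F_2}} :=
  [set f : {ffun fanoV -> 'F_2} | `[< scalar f >]].

End FanoVectorSpace.

Section FanoAut.
Variable F : fanoPlane.

Definition Aut_fano : {set {perm F}} :=
  [set g : {perm F} | [forall l in lines F, g @: l \in lines F]].

Lemma Aut_fano_group_set : group_set Aut_fano.
Proof.
apply/group_setP; split.
  rewrite inE; apply/forall_inP => l lF.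
  by rewrite (_ : _ @: l = l) // -[RHS]imset_id; apply: eq_imset => P; rewrite perm1.
move=> g h /[!inE] /forall_inP gA /forall_inP hA; apply/forall_inP => l lF.
rewrite (_ : _ @: l = h @: (g @: l)) ?hA ?gA // -imset_comp.
by apply: eq_imset => P; rewrite permM.
Qed.

Canonical Aut_fano_group := Group Aut_fano_group_set.

End FanoAut.

Section OrientedMaps.
Variable F : fanoPlane.

Definition oriented_maps : {set {ffun F -> {ffun fanoV F -> 'F_2}}} :=
  [set alpha : {ffun F -> {ffun fanoV F -> 'F_2}} |
   [&& [forall P, alpha P \in fano_dual F],
       [forall P, alpha P (fano_pt P) == 1] &
       [forall P, forall Q, (P != Q) ==>
          (alpha P (fano_pt Q) + alpha Q (fano_pt P) == 1)]]].

(* MathComp actions are right actions and permutations compose from left to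
   right, so precomposing with the inverse g^-1 is indeed an action. *)
Definition oriented_act (alpha : {ffun F -> {ffun fanoV F -> 'F_2}})
    (g : {perm F}) : {ffun F -> {ffun fanoV F -> 'F_2}} :=
  [ffun P => [ffun v : fanoV F => alpha (g^-1%g P) (omap (g^-1)%g v)]].

Lemma oriented_act1 alpha : oriented_act alpha 1%g = alpha.
Proof.
apply/ffunP => P; apply/ffunP => -[Q|]; rewrite !ffunE invg1 perm1 //=.
by rewrite perm1.
Qed.

Lemma oriented_actM alpha :
  act_morph oriented_act alpha.
Proof.
move=> g h; apply/ffunP => P; apply/ffunP => -[Q|];
by rewrite !ffunE invMg /= ?permM.
Qed.

Canonical oriented_action := TotalAction oriented_act1 oriented_actM.

End OrientedMaps.

Section CompositionFactors.
Variable F : fanoPlane.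

Definition S2 : finType := seq_sub [:: 1; -1 : int].

Definition distinct_pair : finType := {x : F * F | dpair x}.

Definition factor : finType := {ffun distinct_pair -> S2}.

(* The integer epsilon_PQ, extended by the junk value 0 when P = Q. *)
Definition factor_val (eps : factor) (P Q : F) : int :=
  if insub (P, Q) is Some x then val (eps x) else 0.

Definition multiplication_factor (eps : factor) : Prop :=
  forall P Q : F, P != Q -> factor_val eps Q P = - factor_val eps P Q.

Section Algebra.
Variable K : fieldType.

(* Coordinates on O_F: the index 0 = None of fanoV F stands for the basis
   vector 1, the index P for e_P. *)
Definition octo : lmodType K := {ffun fanoV F -> K^o}.

Definition octo_basis (u : fanoV F) : octo := [ffun v => (v == u)%:R].

Definition octo_basis_mul (eps : factor) (u v : fanoV F) : octo :=
  match u, v with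
  | None, _ => octo_basis v
  | _, None => octo_basis u
  | Some P, Some Q =>
      if P == Q then - octo_basis 0
      else (factor_val eps P Q)%:~R *: octo_basis (fano_pt P + fano_pt Q)
  end.

Definition octo_mul (eps : factor) (Z W : octo) : octo :=
  \sum_u \sum_v (Z u * W v) *: octo_basis_mul eps u v.

Definition octo_norm (Z : octo) : K := \sum_u Z u ^+ 2.

Definition composition_factor (eps : factor) : Prop :=
  multiplication_factor eps /\
  forall Z W : octo, octo_norm (octo_mul eps Z W) = octo_norm Z * octo_norm W.

End Algebra.

Definition future (eps : factor) (P : F) : {set F} :=
  [set Q | factor_val eps P Q == 1].

Definition past (eps : factor) (P : F) : {set F} :=
  [set Q | factor_val eps P Q == -1].

Definition future_line_factors (K : fieldType) : {set factor} :=
  [set eps : factor | `[< composition_factor K eps >] &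
    [forall P, future eps P \in lines F]].

Definition past_line_factors (K : fieldType) : {set factor} :=
  [set eps : factor | `[< composition_factor K eps >] &
    [forall P, past eps P \in lines F]].

Lemma distinct_pair_perm_subproof (g : {perm F}) (x : distinct_pair) :
  dpair (g (val x).1, g (val x).2).
Proof. by rewrite /= (inj_eq perm_inj); case: x. Qed.

Definition distinct_pair_perm (g : {perm F}) (x : distinct_pair) :
  distinct_pair := Sub (g (val x).1, g (val x).2) (distinct_pair_perm_subproof g x).

Definition factor_act (eps : factor) (g : {perm F}) : factor :=
  [ffun x => eps (distinct_pair_perm g^-1%g x)].

Lemma factor_act1 eps : factor_act eps 1%g = eps.
Proof.
apply/ffunP => x; rewrite ffunE; congr (eps _); apply: val_inj => /=.
by rewrite invg1 !perm1 -surjective_pairing.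
Qed.

Lemma factor_actM eps : act_morph factor_act eps.
Proof.
move=> g h; apply/ffunP => x; rewrite !ffunE; congr (eps _).
by apply: val_inj; rewrite /= invMg !permM.
Qed.

Canonical factor_action := TotalAction factor_act1 factor_actM.

End CompositionFactors.

(* Main.v *)
(* An oriented map sends P to a linear form t_P; pick A <> B in the kernel of t_P,
   named so that t_A(B) = 0.  In the basis (P, A, B) the antisymmetry
   t_X(Y) = 1 + t_Y(X) forces all the forms t_X, hence all oriented maps agree up
   to a change of basis, that is, up to Aut(F).  If the future (or the past) of
   every point for epsilon is a line, the complements of these lines define an
   oriented map, so epsilon has the same normal form; in this form, the
   composition property is an explicit eight-square identity, valid over any
   commutative ring. *)
Require Import Defs.
From mathcomp Require Import all_boot all_order all_algebra all_fingroup.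
From mathcomp Require Import boolp ring.

Set Implicit Arguments.
Unset Strict Implicit.
Unset Printing Implicit Defensive.

Import GRing.Theory.
Local Open Scope ring_scope.

(** * The normal form in coordinates and the eight-square identity *)

Notation bool3 := (bool * bool * bool)%type.

(* The normal form: std x y is t_x(y) for the oriented map whose forms at
   e1, e2, e3 are (1, 0, 0), (1, 1, 0), (1, 1, 1).  The coefficient of t_x at e_i
   is t_x(e_i) = 1 + t_{e_i}(x), unless x = e_i. *)
Definition std (x y : bool3) : bool :=
  let: (x1, x2, x3) := x in let: (y1, y2, y3) := y in
  y1 && ((x == (true, false, false)) || ~~ x1) (+)
  (y2 && ((x == (false, true, false)) || ~~ (x1 (+) x2)) (+)
  y3 && ((x == (false, false, true)) || ~~ (x1 (+) x2 (+) x3))).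

(** The exponent of -1 in the product of the basis octonions indexed by [x] and [y], where 0 indexes
    the unit; [b] exchanges futures and pasts. *)
Definition oct_sign (b : bool) (x y : bool3) : bool :=
  if x == 0 then false else if y == 0 then false else
  if x == y then true else b (+) std x y.

Lemma bool3_addE (p q r p' q' r' : bool) :
  (p, q, r) + (p', q', r') = (p (+) p', q (+) q', r (+) r').
Proof. by []. Qed.

Lemma bool3_addvv (x : bool3) : x + x = 0.
Proof. by case: x => -[[] []] []. Qed.

Lemma big_bool3 (V : nmodType) (G : bool3 -> V) : \sum_x G x =
  G (true, true, true) + G (true, true, false) +
    (G (true, false, true) + G (true, false, false)) +
  (G (false, true, true) + G (false, true, false) +
    (G (false, false, true) + G (false, false, false))).
Proof.
transitivity (\sum_(p : bool * bool) \sum_(z : bool) G (p, z)).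
  by rewrite [RHS]pair_bigA; apply: eq_bigr => -[].
transitivity (\sum_(x : bool) \sum_(y : bool) \sum_(z : bool) G (x, y, z)).
  by rewrite [RHS]pair_bigA; apply: eq_bigr => -[].
by rewrite !big_bool.
Qed.

(** Since [x + (x + z) = z], the inner sum is the coordinate at [z] of the product of [X] and [Y];
    written out, both sides are the same polynomial in sixteen variables. *)
Lemma eight_squares (K : comNzRingType) b (X Y : bool3 -> K) :
  \sum_z (\sum_x (-1) ^+ oct_sign b x (x + z) * X x * Y (x + z)) ^+ 2 =
  (\sum_x X x ^+ 2) * (\sum_x Y x ^+ 2).
Proof.
by rewrite !big_bool3 !bool3_addE; case: b; rewrite /oct_sign /=; ring.
Qed.

Lemma std_addr x : {morph std x : y z / y + z >-> y (+) z}.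
Proof. by case: x => [[[] []] []] [[[] []] []] [[[] []] []]. Qed.

Lemma std_diag x : x != 0 -> std x x.
Proof. by case: x => [[[] []] []]. Qed.

Lemma std_anti x y : x != 0 -> y != 0 -> x != y -> std x y = ~~ std y x.
Proof. by case: x => [[[] []] []]; case: y => [[[] []] []]. Qed.

(** * Linear forms and coordinates on V_F *)

Section Frames.
Variable F : fanoPlane.
Implicit Types (P Q R : F) (u v w : fanoV F).

Lemma fano_ptD P Q : P != Q -> fano_pt P + fano_pt Q = fano_pt (third P Q).
Proof. by move=> PQ; rewrite /GRing.add /= (negPf PQ). Qed.

Lemma fano_ptP u : u != 0 -> exists P, u = fano_pt P.
Proof. by case: u => // P _; exists P. Qed.

Lemma fano_pt_neq0 P : fano_pt P != 0.
Proof. by []. Qed.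

Lemma fano_pt_inj : injective (@fano_pt F).
Proof. by move=> P Q []. Qed.

Lemma fanoV_add_eq0 u v : (u + v == 0) = (u == v).
Proof.
apply/eqP/eqP => [uv|->]; last exact: fanoV_addvv.
by rewrite -[v]add0r -uv -addrA fanoV_addvv addr0.
Qed.

Lemma card_fanoV : #|{: fanoV F}| = 8%N.
Proof. by rewrite card_option card_points. Qed.

Lemma fanoV_avoid (s : seq (fanoV F)) : (size s < 8)%N -> exists u, u \notin s.
Proof.
move=> s8; apply/existsP; apply: contraLR s8; rewrite negb_exists -leqNgt.
move/forallP=> sP; rewrite -card_fanoV; apply: leq_trans (card_size s).
by apply/subset_leq_card/subsetP => u _; have /negPn := sP u.
Qed.

(** Linear forms on V_F, with [bool] standing for Z_2: over this field additive maps are linear. *)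
Definition fadditive (c : fanoV F -> bool) := {morph c : u v / u + v >-> u (+) v}.

Lemma fadditive0 c : fadditive c -> c 0 = false.
Proof. by move=> cD; rewrite -[0]addr0 cD addbb. Qed.

Lemma fadditive_bool c u (b : bool) : fadditive c -> c (u *+ b) = b && c u.
Proof. by move=> cD; case: b; rewrite ?mulr1n // mulr0n fadditive0. Qed.

(** The map [k] below is the projection onto the kernel of [c] along [p]; it kills only 0 and
    [p]. *)
Lemma kernel_pair (c : fanoV F -> bool) p : fadditive c -> c p ->
  exists a b, [/\ a != 0, b != 0, a != b, c a = false & c b = false].
Proof.
move=> cD cp; pose k u := u + p *+ c u.
have ck u : c (k u) = false by rewrite cD fadditive_bool // cp andbT addbb.
have [q] := @fanoV_avoid [:: 0; p] isT.
rewrite !inE negb_or => /andP[q0 qp].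
(* Excluding [q + p] too puts [r] and [q] in different cosets of {0, [p]}, so their projections
   differ. *)
have [r] := @fanoV_avoid [:: 0; p; q; q + p] isT.
rewrite !inE !negb_or => /and4P[r0 rp rq rqp].
have k0 u : u != 0 -> u != p -> k u != 0.
  by rewrite /k fanoV_add_eq0; case: (c u).
exists (k q), (k r); split; rewrite ?ck ?k0 //.
rewrite /k; case: (c q) (c r) => -[]; rewrite ?addr0 ?mulr1n ?mulr0n.
- by rewrite (inj_eq (addIr p)) eq_sym.
- by rewrite eq_sym.
- by rewrite -fanoV_add_eq0 addrA addrAC fanoV_add_eq0 eq_sym.
- by rewrite eq_sym.
Qed.

Definition frame p a b (x : bool3) : fanoV F :=
  let: (x1, x2, x3) := x in p *+ x1 + (a *+ x2 + b *+ x3).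

Lemma frameD p a b : {morph frame p a b : x y / x + y}.
Proof.
have mulD u (c d : bool) : u *+ (c (+) d) = u *+ c + u *+ d.
  by case: c; case: d; rewrite ?addr0 ?add0r // fanoV_addvv.
move=> [[x1 x2] x3] [[y1 y2] y3]; rewrite bool3_addE /= !mulD.
by rewrite [RHS]addrACA; congr (_ + _); rewrite [RHS]addrACA.
Qed.

Lemma frame0 p a b : frame p a b 0 = 0.
Proof. by rewrite -(bool3_addvv 0) frameD fanoV_addvv. Qed.

Lemma frame_additive p a b c (x : bool3) : fadditive c ->
  c (frame p a b x) = x.1.1 && c p (+) (x.1.2 && c a (+) x.2 && c b).
Proof. by case: x => [[x1 x2] x3] cD; rewrite !cD !fadditive_bool. Qed.

(** On a combination of [p], [a], [b] the form [c] reads off the coefficient of [p]; distinct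
    nonzero [a] and [b] are independent over Z_2. *)
Lemma frame_inj p a b c : fadditive c -> c p -> c a = false -> c b = false ->
  a != 0 -> b != 0 -> a != b -> injective (frame p a b).
Proof.
move=> cD cp ca cb a0 b0 ab.
have ker x : frame p a b x = 0 -> x = 0.
  move=> x0; have := frame_additive p a b x cD.
  rewrite x0 fadditive0 // cp ca cb !andbF !addbF andbT.
  case: x x0 => [[x1 x2] x3] /= x0 x1F; move: x0; rewrite -x1F mulr0n add0r.
  case: x2 x3 => -[] //; rewrite ?mulr1n ?mulr0n ?addr0 ?add0r => /eqP.
  - by rewrite fanoV_add_eq0 (negPf ab).
  - by rewrite (negPf a0).
  - by rewrite (negPf b0).
move=> x y xy; apply/esym; rewrite -[y]add0r -(ker (x + y)).
  by rewrite -addrA bool3_addvv addr0.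
by rewrite frameD xy fanoV_addvv.
Qed.

Lemma bool3_bij (phi : bool3 -> fanoV F) : injective phi -> bijective phi.
Proof.
by move=> phiI; apply: inj_card_bij => //; rewrite card_fanoV !card_prod card_bool.
Qed.

(** * Lines as kernels of linear forms *)

Lemma linesP (l : {set F}) :
  reflect (exists P Q, P != Q /\ l = [set P; Q; third P Q]) (l \in lines F).
Proof.
have third_sub m P Q : m \in lines F -> P != Q -> P \in m -> Q \in m ->
    m = [set P; Q; third P Q].
  move=> mF PQ Pm Qm; have [Tm _ _ Tu] := thirdP PQ mF Pm Qm.
  apply/setP => R; rewrite !inE -orbA; apply/idP/or3P => [Rm|]; last first.
    by case=> /eqP->.
  case: (eqVneq R P) => [|RP]; first by constructor.
  case: (eqVneq R Q) => [|RQ]; first by constructor.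
  by constructor 3; rewrite (Tu R).
apply: (iffP idP) => [lF|[P [Q [PQ ->]]]]; last first.
  by have [m [mF Pm Qm]] := line_exists PQ; rewrite -(third_sub m).
have : (1 < #|l|)%N by rewrite card_line.
by case/card_gt1P => P [Q [Pl Ql PQ]]; exists P, Q; split; last exact: third_sub.
Qed.

(** The kernel is a plane spanned by some [a] and [b], and its nonzero vectors [a], [b], [a + b]
    form a line. *)
Lemma kernel_line c P : fadditive c -> c (fano_pt P) ->
  [set Q | ~~ c (fano_pt Q)] \in lines F.
Proof.
move=> cD cP; have [a [b [a0 b0 ab ca cb]]] := kernel_pair cD cP.
have [phi _ phiK] := bool3_bij (frame_inj cD cP ca cb a0 b0 ab).
have [A aE] := fano_ptP a0; have [B bE] := fano_ptP b0.
have AB : A != B by move: ab; rewrite aE bE (inj_eq fano_pt_inj).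
apply/linesP; exists A, B; split => //; apply/setP => Q; rewrite !inE.
rewrite -!(inj_eq fano_pt_inj) -fano_ptD // -aE -bE -orbA.
apply/idP/or3P => [|[] /eqP->]; rewrite ?cD ?ca ?cb //.
have := fano_pt_neq0 Q; rewrite -[fano_pt Q]phiK frame_additive // cP ca cb.
case: (phi _) => [[[] [|]] [|]] //=; rewrite ?mulr1n ?mulr0n ?addr0 ?add0r ?eqxx //;
  by [constructor 1 | constructor 2 | constructor 3].
Qed.

Definition line_form (l : {set F}) u : bool :=
  if u is Some P then P \notin l else false.

(** A line [m] other than [l] meets [l] in one point, so among three collinear points the number
    lying off [l] is 0 or 2, hence even. *)
Lemma line_formD (l : {set F}) : l \in lines F -> fadditive (line_form l).
Proof.
move=> lF [P|] [Q|]; rewrite ?addr0 ?add0r ?addbF //.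
case: (eqVneq P Q) => [->|PQ]; first by rewrite fanoV_addvv addbb.
rewrite [_ + _](fano_ptD PQ) /=.
have [m [mF Pm Qm]] := line_exists PQ; have [Tm TP TQ _] := thirdP PQ mF Pm Qm.
case: (eqVneq l m) => [->|lm]; first by rewrite Pm Qm Tm.
have meet X Y : X \in m -> Y \in m -> X \in l -> Y \in l -> X = Y.
  by move=> Xm Ym Xl Yl; apply: (point_unique lF mF lm).
case: (boolP (P \in l)) => Pl /=.
  have -> /= : Q \notin l by apply: contraNN PQ => /(meet P Q Pm Qm Pl)->.
  by apply: contraNN TP => /(meet _ P Tm Pm)->.
case: (boolP (Q \in l)) => Ql /=.
  by apply: contraNN TQ => /(meet _ Q Tm Qm)->.
(* With [P] and [Q] both off [l], the meeting point of [l] and [m] can only be the third point of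
   [m]. *)
apply/negPn; have /eqP/cards1P[X XE] := fano_meet lF mF lm.
have /[!inE]/andP[Xl Xm] : X \in l :&: m by rewrite XE inE.
have [_ _ _ /(_ X Xm)<-] // := thirdP PQ mF Pm Qm.
  by apply: contraNneq Pl => <-.
by apply: contraNneq Ql => <-.
Qed.

(** * The identification of Aut(F) with GL(V_F) *)

Lemma Aut_fanoD g : g \in Aut_fano F -> {morph (omap g : fanoV F -> fanoV F) : u v / u + v}.
Proof.
rewrite inE => /forall_inP gA [P|] [Q|]; rewrite ?addr0 ?add0r //.
case: (eqVneq P Q) => [->|PQ]; first by rewrite !fanoV_addvv.
have gPQ : g P != g Q by rewrite (inj_eq perm_inj).
rewrite [_ + _](fano_ptD PQ) /= [RHS](fano_ptD gPQ); congr Some.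
have [m [mF Pm Qm]] := line_exists PQ; have [Tm TP TQ _] := thirdP PQ mF Pm Qm.
apply/esym/(third_eq (gA m mF)); rewrite ?(inj_eq perm_inj) //; exact: imset_f.
Qed.

(** Being injective with [h 0 = 0], [h] permutes the points; it preserves lines because these are
    the sets {P, Q, P + Q}. *)
Lemma Aut_fano_of_additive (h : fanoV F -> fanoV F) : injective h ->
  {morph h : u v / u + v} ->
  exists2 g, g \in Aut_fano F & forall u, omap g u = h u.
Proof.
move=> hI hD; have h0 : h 0 = 0 by rewrite -(fanoV_addvv 0) hD fanoV_addvv.
have hP P : exists Q, h (fano_pt P) == fano_pt Q.
  have [|Q ->] := @fano_ptP (h (fano_pt P)); last by exists Q.
  by rewrite -h0 (inj_eq hI).
pose f P := xchoose (hP P).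
have fE P : fano_pt (f P) = h (fano_pt P) by apply/esym/eqP/(xchooseP (hP P)).
have fI : injective f.
  by move=> P Q PQ; apply/fano_pt_inj/hI; rewrite -!fE PQ.
exists (perm fI) => [|[P|]]; last 2 first.
- by rewrite /= permE; apply: fE.
- by rewrite /= h0.
rewrite inE; apply/forall_inP => l /linesP[P [Q [PQ ->]]].
have gPQ : f P != f Q by rewrite (inj_eq fI).
apply/linesP; exists (f P), (f Q); split => //.
rewrite !imsetU !imset_set1 !permE; congr (_ :|: [set _]).
by apply: fano_pt_inj; rewrite -fano_ptD // !fE -hD fano_ptD.
Qed.

(** * Oriented maps with Boolean values: normal form, conjugacy, existence *)

Definition oriented (t : F -> fanoV F -> bool) : Prop :=
  [/\ forall P, fadditive (t P), forall P, t P (fano_pt P) &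
      forall P Q, P != Q -> t P (fano_pt Q) = ~~ t Q (fano_pt P)].

(** This is the action of the inverse of [g]. *)
Definition oriented_pull (g : {perm F}) (t : F -> fanoV F -> bool) P u :=
  t (g P) (omap g u).

Lemma oriented_pullP g t : g \in Aut_fano F -> oriented t ->
  oriented (oriented_pull g t).
Proof.
move=> gA [tD tP tN]; split=> [P u v|P|P Q PQ].
- by rewrite /oriented_pull (Aut_fanoD gA) tD.
- exact: tP.
- by apply: tN; rewrite (inj_eq perm_inj).
Qed.

Lemma oriented_frame t : oriented t -> exists phi : bool3 -> fanoV F,
  [/\ injective phi, {morph phi : x y / x + y} &
      forall x y P, phi x = fano_pt P -> t P (phi y) = std x y].
Proof.
case=> tD tP tN; have /card_gt0P[P _] : (0 < #|F|)%N by rewrite card_points.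
have [a [b []]] := kernel_pair (tD P) (tP P).
case/fano_ptP=> A ->{a} /fano_ptP[B ->{b}]; rewrite (inj_eq fano_pt_inj).
(* Exactly one of t_A(B) and t_B(A) vanishes, so exchanging [A] and [B] if necessary achieves
   this. *)
wlog tAB : A B / t A (fano_pt B) = false => [hw|] AB tPA tPB.
  case: (boolP (t A (fano_pt B))) => [tAB|/negPf tAB]; last exact: (hw A B).
  by apply: (hw B A); rewrite 1?eq_sym // tN 1?eq_sym // tAB.
have phiI := frame_inj (tD P) (tP P) tPA tPB (fano_pt_neq0 A) (fano_pt_neq0 B) AB.
exists (frame (fano_pt P) (fano_pt A) (fano_pt B)); split => //; first exact: frameD.
set phi := frame _ _ _ in phiI *.
have eP : phi (true, false, false) = fano_pt P by rewrite /phi /= !mulr0n mulr1n !addr0.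
have eA : phi (false, true, false) = fano_pt A by rewrite /phi /= !mulr0n mulr1n addr0 add0r.
have eB : phi (false, false, true) = fano_pt B by rewrite /phi /= !mulr0n mulr1n !add0r.
(* Antisymmetry expresses the coefficients of every form t_X through the values at X of the three
   forms at the basis points. *)
have coef x X e E : phi x = fano_pt X -> phi e = fano_pt E ->
    t X (fano_pt E) = (x == e) || ~~ t E (phi x).
  move=> xX eE; rewrite -(inj_eq phiI) xX eE (inj_eq fano_pt_inj).
  by case: eqVneq => [->|XE]; [rewrite tP | rewrite tN].
have PA : P != A by apply: contraFneq tPA => <-; apply: tP.
have PB : P != B by apply: contraFneq tPB => <-; apply: tP.
(* Antisymmetry completes the three basis forms to (1, 0, 0), (1, 1, 0), (1, 1, 1). *)
have tAP : t A (fano_pt P) by rewrite tN 1?eq_sym // tPA.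
have tBP : t B (fano_pt P) by rewrite tN 1?eq_sym // tPB.
have tBA : t B (fano_pt A) by rewrite tN 1?eq_sym // tAB.
move=> x y X xX; rewrite frame_additive // (coef x X _ _ xX eP) (coef x X _ _ xX eA).
rewrite (coef x X _ _ xX eB) !frame_additive // !tP tPA tPB tAP tAB tBP tBA.
by case: x {xX} => [[x1 x2] x3]; case: y => [[y1 y2] y3]; rewrite /= !andbT ?andbF !addbF !addbA.
Qed.

(** Both maps become [std] in coordinates [phi] and [psi], so the linear bijection [psi \o phi']
    carries one to the other. *)
Lemma oriented_conj t t' : oriented t -> oriented t' ->
  exists2 g, g \in Aut_fano F & t = oriented_pull g t'.
Proof.
move=> /oriented_frame[phi [phiI phiD tE]] /oriented_frame[psi [psiI psiD t'E]].
have [phi' phiK phi'K] := bool3_bij phiI.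
have [|u v|g gA gE] := @Aut_fano_of_additive (psi \o phi').
- exact: inj_comp psiI (can_inj phi'K).
- by rewrite /= -psiD -[in RHS](phiK (_ + _)) phiD !phi'K.
exists g => //; apply/funext => P; apply/funext => u.
rewrite /oriented_pull gE /= -{1}[u]phi'K (tE (phi' (fano_pt P))) ?phi'K //.
by apply/esym/t'E; rewrite -[LHS]/((psi \o phi') (fano_pt P)) -gE.
Qed.

(** Transitivity on a set includes nonemptiness. The form [std] is transported along a frame built
    from a line and a point off it. *)
Lemma oriented_exists : exists t, oriented t.
Proof.
have /card_gt0P[l lF] : (0 < #|lines F|)%N by rewrite card_lines.
have [P Pl] : exists P, P \notin l.
  apply/existsP; rewrite -negb_forall; apply/negP => /forallP lT.
  have : #|l| = #|F| by apply: eq_card => P; rewrite lT.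
  by rewrite card_points card_line.
have cD := line_formD lF; have cP : line_form l (fano_pt P) := Pl.
have [a [b [a0 b0 ab ca cb]]] := kernel_pair cD cP.
have phiI := frame_inj cD cP ca cb a0 b0 ab.
have [phi' phiK phi'K] := bool3_bij phiI.
have phi'D : {morph phi' : u v / u + v}.
  by move=> u v; apply: phiI; rewrite frameD !phi'K.
have phi'0 Q : phi' (fano_pt Q) != 0.
  by rewrite -(inj_eq phiI) phi'K frame0.
exists (fun Q u => std (phi' (fano_pt Q)) (phi' u)); split=> [Q u v|Q|Q R QR].
- by rewrite phi'D std_addr.
- exact: std_diag.
- by rewrite std_anti // (can_eq phi'K) (inj_eq fano_pt_inj).
Qed.

(** The argument shared by the three sets: [enc] identifies [S] equivariantly with the Boolean
    oriented maps, which form a single orbit. *)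
Lemma transitive_encoding (T : finType) (to : {action {perm F} &-> T})
    (S : {set T}) (enc : T -> F -> fanoV F -> bool) :
  injective enc -> (forall x, x \in S <-> oriented (enc x)) ->
  (forall t, oriented t -> exists x, enc x = t) ->
  (forall x g, enc (to x g) = oriented_pull g^-1 (enc x)) ->
  [transitive Aut_fano F, on S | to].
Proof.
move=> encI encS encT encA; have [t tO] := oriented_exists.
have [x xE] := encT t tO; rewrite -xE in tO.
apply/imsetP; exists x; first exact/encS.
apply/setP => y; apply/idP/orbitP => [/encS yO|[g gA <-]]; last first.
  by apply/encS; rewrite encA; apply: oriented_pullP; rewrite ?groupV.
have [g gA yE] := oriented_conj yO tO.
by exists g^-1%g; rewrite ?groupV //; apply: encI; rewrite encA invgK yE.
Qed.

End Frames.

(** * Transfer to oriented maps with values in the dual space *)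

Lemma F2_eq1_inj : injective (fun a : 'F_2 => a == 1).
Proof. by move=> [[|[|?]] ?] [[|[|?]] ?] //= E; apply: val_inj. Qed.

Lemma F2_eq1D (a b : 'F_2) : (a + b == 1) = (a == 1) (+) (b == 1).
Proof. by case: a b => [[|[|?]] ?] [[|[|?]] ?]. Qed.

Section OrientedMaps.
Variable F : fanoPlane.
Implicit Type alpha : {ffun F -> {ffun fanoV F -> 'F_2}}.

Definition map_form alpha P u : bool := alpha P u == 1.

Lemma map_form_inj : injective map_form.
Proof.
move=> alpha beta ab; apply/ffunP => P; apply/ffunP => u.
exact/F2_eq1_inj/(congr1 (fun t => t P u) ab).
Qed.

Lemma fano_dualE (f : {ffun fanoV F -> 'F_2}) :
  f \in fano_dual F <-> fadditive (fun u => f u == 1).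
Proof.
rewrite inE; split=> [/asboolP fL u v|fD].
  by rewrite -F2_eq1D -[f u]mul1r -fL scale1r.
have {}fD u v : f (u + v) = f u + f v.
  by apply: F2_eq1_inj; rewrite /= fD F2_eq1D.
have f0 : f 0 = 0 by apply: (addIr (f 0)); rewrite -fD !add0r.
apply/asboolP => a u v; rewrite fD; congr (_ + _).
(* The only scalars are 0 and 1, so additivity gives linearity. *)
have [->|->] : a = 0 \/ a = 1.
  by case: a => [[|[|?]] ?]; [left|right|]; try exact: val_inj.
- by rewrite scale0r mul0r.
- by rewrite scale1r mul1r.
Qed.

Lemma oriented_mapsE alpha :
  alpha \in oriented_maps F <-> oriented (map_form alpha).
Proof.
have N1 (a b : 'F_2) : (a + b == 1) = ((a == 1) == ~~ (b == 1)).
  by rewrite F2_eq1D; case: (a == 1); case: (b == 1).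
rewrite inE; split=> [/and3P[/forallP aD /forallP aP /'forall_forallP aN]|[aD aP aN]].
  split=> // [P|P Q PQ]; first exact/fano_dualE.
  by have := aN P Q; rewrite PQ N1 => /eqP.
apply/and3P; split; first by apply/forallP => P; apply/fano_dualE/aD.
  by apply/forallP => P; exact: aP.
by apply/'forall_forallP => P Q; apply/implyP => PQ; rewrite N1; apply/eqP/aN.
Qed.

Lemma map_form_surj t : oriented t -> exists alpha, map_form alpha = t.
Proof.
move=> tO; exists [ffun P => [ffun u => (t P u)%:R]].
apply/funext => P; apply/funext => u.
by rewrite /map_form !ffunE; case: (t P u).
Qed.

Lemma map_form_act alpha g :
  map_form (oriented_act alpha g) = oriented_pull g^-1 (map_form alpha).
Proof.
by apply/funext => P; apply/funext => u; rewrite /map_form !ffunE.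
Qed.

End OrientedMaps.

(** * Transfer to composition factors, futures and pasts together *)

Section SignedFactors.
Variables (F : fanoPlane) (b : bool).
Implicit Type eps : factor F.

(* b = false is the case of futures, b = true that of pasts. *)
Definition factor_form eps P (u : fanoV F) : bool :=
  if u is Some Q then factor_val eps P Q != (-1) ^+ b else false.

(** The default value 0 differs from both signs, which gives the form at [P] the value 1 on [P]
    itself. *)
Lemma factor_val_diag eps P : factor_val eps P P = 0.
Proof. by rewrite /factor_val insubN //= negbK. Qed.

Lemma factor_val_Sub eps P Q (PQ : dpair (P, Q)) :
  factor_val eps P Q = val (eps (Sub (P, Q) PQ)).
Proof. by rewrite /factor_val insubT. Qed.

Lemma factor_valE eps P Q : P != Q ->
  factor_val eps P Q = (-1) ^+ (b (+) factor_form eps P (fano_pt Q)).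
Proof.
move=> PQ; rewrite /factor_form /= (factor_val_Sub eps (PQ : dpair (P, Q))).
by case: (eps _) => s /=; rewrite !inE => /pred2P[] ->; case: b.
Qed.

Lemma factor_form_inj : injective factor_form.
Proof.
move=> eps eta ee; apply/ffunP => -[[P Q] PQ]; apply: val_inj.
by rewrite /= -!factor_val_Sub !factor_valE // ee.
Qed.

Lemma factor_form_surj t : oriented t -> exists eps, factor_form eps = t.
Proof.
case=> tD tP tN.
have sP (c : bool) : (-1) ^+ c \in [:: 1; -1 : int] by case: c.
pose s c : S2 := SeqSub (sP c).
exists [ffun x : distinct_pair F => s (b (+) t (val x).1 (fano_pt (val x).2))].
apply/funext => P; apply/funext => -[Q|]; last by rewrite /= fadditive0.
rewrite /=; case: (eqVneq P Q) => [->|PQ].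
  by rewrite factor_val_diag [RHS]tP; case: b.
rewrite (factor_val_Sub _ (PQ : dpair (P, Q))) ffunE /= -/(fano_pt Q).
by case: (t P _); case: b.
Qed.

Lemma factor_form_act eps g :
  factor_form (factor_act eps g) = oriented_pull g^-1 (factor_form eps).
Proof.
apply/funext => P; apply/funext => -[Q|] //; rewrite /oriented_pull /=.
case: (eqVneq P Q) => [->|PQ]; first by rewrite !factor_val_diag.
have gPQ : dpair (g^-1%g P, g^-1%g Q) by rewrite /= (inj_eq perm_inj).
rewrite (factor_val_Sub _ (PQ : dpair (P, Q))) (factor_val_Sub _ gPQ) ffunE.
by congr (val (eps _) != _); apply: val_inj.
Qed.

Variable K : fieldType.

(** In normal-form coordinates the structure constants no longer depend on [eps]. *)
Lemma octo_basis_mulE eps (phi : bool3 -> fanoV F) x y :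
  injective phi -> {morph phi : x y / x + y} ->
  (forall x y P, phi x = fano_pt P -> factor_form eps P (phi y) = std x y) ->
  octo_basis_mul K eps (phi x) (phi y) =
    (-1) ^+ oct_sign b x y *: octo_basis K (phi (x + y)).
Proof.
move=> phiI phiD fE; have phi0 : phi 0 = 0.
  by rewrite -(bool3_addvv 0) phiD fanoV_addvv.
rewrite /oct_sign; case: eqVneq => [->|x0].
  by rewrite phi0 add0r scale1r.
case: eqVneq => [->|y0].
  by rewrite phi0 addr0 scale1r; case: (phi x).
rewrite -(inj_eq phiI) phi0 in x0; rewrite -(inj_eq phiI) phi0 in y0.
have [P xP] := fano_ptP x0; have [Q yQ] := fano_ptP y0.
rewrite -(fE x y P xP) -(inj_eq phiI) phiD xP yQ (inj_eq (@fano_pt_inj F)) [LHS]/=.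
case: eqVneq => [->|PQ]; first by rewrite fanoV_addvv scaleN1r.
by rewrite factor_valE // rmorphXn rmorphN1.
Qed.

(** Reindexing all sums by normal-form coordinates turns multiplicativity of the norm into
    [eight_squares]. *)
Lemma factor_form_composition eps :
  oriented (factor_form eps) -> composition_factor K eps.
Proof.
move=> eO; have [_ _ eN] := eO; split=> [P Q PQ|Z W].
  have QP : Q != P by rewrite eq_sym.
  by rewrite (factor_valE _ PQ) (factor_valE _ QP) (eN Q P QP) addbN signrN.
have [phi [phiI phiD fE]] := oriented_frame eO.
have phiB := onW_bij predT (bool3_bij phiI).
rewrite /octo_norm !(reindex phi phiB) /= -(eight_squares b).
apply: eq_bigr => z _; congr (_ ^+ 2).
rewrite /octo_mul sum_ffunE (reindex phi phiB) /=; apply: eq_bigr => x _.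
(* For fixed [x], only [y = x + z] contributes to the coordinate at [z]. *)
rewrite sum_ffunE (reindex phi phiB) /= (bigD1 (x + z)) //= big1 => [|y yxz].
  rewrite addr0 (octo_basis_mulE _ _ phiI phiD fE) !ffunE.
  rewrite addrA bool3_addvv add0r eqxx.
  by rewrite /GRing.scale /= mulr1 mulrC mulrA.
rewrite (octo_basis_mulE _ _ phiI phiD fE) !ffunE.
rewrite (inj_eq phiI) (_ : z == x + y = false) ?scaler0 //.
by apply: contra_neqF yxz => /eqP->; rewrite addrA bool3_addvv add0r.
Qed.

Definition signed_line_factors : {set factor F} :=
  [set eps : factor F | `[< composition_factor K eps >] &
    [forall P, [set Q | factor_val eps P Q == (-1) ^+ b] \in lines F]].

Lemma factor_form_line eps P :
  [set Q | factor_val eps P Q == (-1) ^+ b] =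
  [set Q | ~~ factor_form eps P (fano_pt Q)].
Proof. by apply/setP => Q; rewrite !inE negbK. Qed.

(** Lines give linear forms, and skew-symmetry of [eps] gives antisymmetry. Conversely, kernels are
    lines and the normal form gives composition. *)
Lemma signed_line_factorsE eps :
  eps \in signed_line_factors <-> oriented (factor_form eps).
Proof.
rewrite inE; split=> [/andP[/asboolP[eN _] /forallP eL]|eO].
  split=> [P|P|P Q PQ].
  - have -> : factor_form eps P = line_form [set Q | factor_val eps P Q == (-1) ^+ b].
      by apply/funext => -[Q|] //=; rewrite inE.
    exact: line_formD.
  - by rewrite /factor_form /= factor_val_diag; case: b.
  - have QP : Q != P by rewrite eq_sym.
    have := eN P Q PQ; rewrite (factor_valE _ PQ) (factor_valE _ QP) -signrN.
    by case: (factor_form _ P _) (factor_form _ Q _) => -[] //; case: b.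
apply/andP; split; first exact/asboolP/factor_form_composition.
apply/forallP => P; rewrite factor_form_line.
by have [eD eP _] := eO; apply: kernel_line (eP P).
Qed.

Lemma signed_line_factors_transitive :
  [transitive Aut_fano F, on signed_line_factors | factor_action F].
Proof.
apply: transitive_encoding factor_form_inj signed_line_factorsE _ _.
  exact: factor_form_surj.
exact: factor_form_act.
Qed.

End SignedFactors.

Theorem theorem2p11 (F : fanoPlane) (K : fieldType)
    (hK : 2%N \notin [pchar K]%R) :
  [/\ [transitive Aut_fano F, on oriented_maps F | oriented_action F],
      [transitive Aut_fano F, on future_line_factors F K | factor_action F] &
      [transitive Aut_fano F, on past_line_factors F K | factor_action F]].
Proof.
split.
- apply: transitive_encoding (@map_form_inj F) (@oriented_mapsE F) _ _.
    exact: map_form_surj.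
  exact: map_form_act.
(* The sign [(-1) ^+ b] computes to 1 for [false] and to -1 for [true], so the sets agree by
   conversion. *)
- exact: (signed_line_factors_transitive F false K).
- exact: (signed_line_factors_transitive F true K).
Qed.
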